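(* In the setting described in the context, let $1\le r\le m$. (1) The sequence $\{\rho(\overline{M}_{r,k}|_{\Theta_{r,k}})\}_{k=1}^\infty$ is decreasing (non-increasing) in $k$. Thus the limit $\lim_{k\to\infty}\rho(\overline{M}_{r,k}|_{\Theta_{r,k}})$ exists; denote it by $\rho_r$. (2) The sequence $\{\rho(\underline{M}_{r,k}|_{\Theta_{r,k}})\}_{k=1}^\infty$ is increasing (non-decreasing) in $k$, and the limit $\lim_{k\to\infty}\rho(\underline{M}_{r,k}|_{\Theta_{r,k}})$ also exists. Moreover, if $S_n$ is positive on $D_n\cap K_r$ for all $n\in\Lambda_r$, then $\lim_{k\to\infty}\rho(\underline{M}_{r,k}|_{\Theta_{r,k}})=\rho_r$.
   Context: Setting. Let $N\ge 2$ and let $(x_0,y_0),\dots,(x_N,y_N)\in\mathbb{R}^2$ with $x_0<x_1<\cdots<x_N$ and $x_n-x_{n-1}=(x_N-x_0)/N$ for $1\le n\le N$. For each $1\le n\le N$ fix integers $0\le u(n)<v(n)\le N$ and put $I_n=[x_{n-1},x_n]$, $D_n=[x_{u(n)},x_{v(n)}]$. Let $L_n(x)=a_nx+b_n$ be an affine contractive homeomorphism of $D_n$ onto $I_n$ ($a_n$ may be negative), and let $S_n,q_n:D_n\to\mathbb{R}$ be continuous functions of bounded variation with $|S_n(x)|<1$ for all $x\in D_n$. With $W_n(x,y)=(L_n(x),S_n(x)y+q_n(x))$ on $D_n\times\mathbb{R}$, assume $W_n(\{(x_{u(n)},y_{u(n)}),(x_{v(n)},y_{v(n)})\})=\{(x_{n-1},y_{n-1}),(x_n,y_n)\}$.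 Components. For $i,j\in\{1,\dots,N\}$ there is an edge from $j$ to $i$ if $I_j\subset D_i$. For $\emptyset\neq V\subset\{1,\dots,N\}$ and $i,j\in V$, a path in $V$ from $j$ to $i$ is a finite sequence $i_0,\dots,i_t$ ($t\ge1$) in $V$ with $i_0=j$, $i_t=i$ and an edge from $i_{\ell-1}$ to $i_\ell$ for each $1\le\ell\le t$. $V$ is strongly connected if for all $i,j\in V$ there is a path in $V$ from $j$ to $i$; a strongly connected component is a strongly connected set that is maximal under inclusion. Let $\Lambda_1,\dots,\Lambda_m$ be all the strongly connected components of $\{1,\dots,N\}$. Standing assumption: for each $r$ there is an integer $T_r\ge2$ with $|D_n|/|I_n|=T_r$ for all $n\in\Lambda_r$ ($|J|$ is the length of $J$). Basic sets. $B_{r,0}=\bigcup_{n\in\Lambda_r}D_n$, $B_{r,k}=\bigcup_{n\in\Lambda_r}L_n(B_{r,k-1}\cap D_n)$ for $k\ge1$ (a decreasing sequence of compact sets), and $K_r=\bigcap_{k\ge0}B_{r,k}$. Also $\mathcal{B}_{r,0}=\{D_n:n\in\Lambda_r\}$, $\mathcal{B}_{r,k}=\{L_n(E):n\in\Lambda_r,\ E\in\mathcal{B}_{r,k-1},\ E\subset D_n\}$ for $k\ge1$. Intervals. Write $\Lambda_r=\{a_{r,1}<\cdots<a_{r,d_r}\}$. For $k\ge1$, $1\le t\le d_r$, $1\le j\le T_r^{k-1}$, let $I^k_{r,(t-1)T_r^{k-1}+j}=\big[x_{a_{r,t}-1}+\tfrac{(j-1)(x_N-x_0)}{NT_r^{k-1}},\,x_{a_{r,t}-1}+\tfrac{j(x_N-x_0)}{NT_r^{k-1}}\big]$.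 Each element of $\mathcal{B}_{r,k}$, $k\ge1$, equals $I^k_{r,i}$ for a unique $i$; put $\Theta_{r,k}=\{1\le i\le d_rT_r^{k-1}: I^k_{r,i}\in\mathcal{B}_{r,k}\}$. For $1\le i\le d_rT_r^{k-1}$ let $n$ be the unique index with $I^k_{r,i}\subset I_n$ and put $D^k_{r,i}=L_n^{-1}(I^k_{r,i})$. Matrices. $\overline{M}_{r,k}$ and $\underline{M}_{r,k}$ are the $d_rT_r^{k-1}\times d_rT_r^{k-1}$ matrices with $(i,j)$ entries $\overline{s}^k_{r,i,j}=\max\{|S_n(x)|:x\in I^k_{r,j}\}$ and $\underline{s}^k_{r,i,j}=\min\{|S_n(x)|:x\in I^k_{r,j}\}$ respectively if $I^k_{r,j}\subset D^k_{r,i}$ (where $n$ is the unique index with $I^k_{r,i}\subset I_n$), and $0$ otherwise. For a square matrix $A$ and a set of indices $\Theta$, $A|_\Theta=(a_{ij})_{i,j\in\Theta}$. $\rho(A)$ denotes the spectral radius of $A$ (maximum modulus of its eigenvalues). *)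

(* Defs.v *)
From HB Require Import structures.
From mathcomp Require Import all_boot all_order all_algebra.
From mathcomp Require Import complex.
From mathcomp Require Import all_classical all_reals all_analysis.

Set Implicit Arguments.
Unset Strict Implicit.
Unset Printing Implicit Defensive.

Import Order.TTheory GRing.Theory Num.Theory.
Import numFieldNormedType.Exports.

Local Open Scope classical_set_scope.
Local Open Scope ring_scope.

(* Maximum modulus of the complex eigenvalues of a real square matrix; the set
   is finite, so that the supremum is a maximum when the size is positive (the
   value for the empty matrix is 0). *)
Definition spectral_radius (R : realType) (p : nat) (A : 'M[R]_p) : R :=
  sup [set ComplexField.Normc.normc z
        | z in [set z : R[i] | eigenvalue (map_mx (real_complex R) A) z]].

(* A|_Theta, with the elements of Theta listed in the order of enum. *)
Definition restrict_mx (R : realType) (p : nat) (A : 'M[R]_p)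
    (Theta : {set 'I_p}) : 'M[R]_(#|Theta|) :=
  mxsub enum_val enum_val A.

(* The maps are indexed by 'I_N, i.e. by 0, ..., N - 1 instead of 1, ..., N:
   the map of index n has target [x_n, x_(n+1)]. Only the values of Sf n and
   qf n on D_n are meaningful. *)
Record rifs (R : realType) (N : nat) := Rifs {
  nodex : 'I_N.+1 -> R;
  nodey : 'I_N.+1 -> R;
  uidx : 'I_N -> 'I_N.+1;
  vidx : 'I_N -> 'I_N.+1;
  slope : 'I_N -> R;
  offset : 'I_N -> R;
  Sf : 'I_N -> R -> R;
  qf : 'I_N -> R -> R }.

Definition lidx (N : nat) (n : 'I_N) : 'I_N.+1 := widen_ord (leqnSn N) n.
Definition ridx (N : nat) (n : 'I_N) : 'I_N.+1 := lift ord0 n.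

Section Rifs.
Context {R : realType} {N : nat} (w : rifs R N).
Implicit Types (n i j : 'I_N) (V : {set 'I_N}).

Definition Iset n : set R :=
  `[nodex w (lidx n), nodex w (ridx n)]%classic.

Definition Dset n : set R :=
  `[nodex w (uidx w n), nodex w (vidx w n)]%classic.

Definition Ilen n : R := nodex w (ridx n) - nodex w (lidx n).

Definition Dlen n : R := nodex w (vidx w n) - nodex w (uidx w n).

(* (x_N - x_0) / N *)
Definition mesh : R := (nodex w ord_max - nodex w ord0) / N%:R.

Definition Lmap n (t : R) : R := slope w n * t + offset w n.

Definition Wmap n (z : R * R) : R * R :=
  (Lmap n z.1, Sf w n z.1 * z.2 + qf w n z.1).

Definition node (k : 'I_N.+1) : R * R := (nodex w k, nodey w k).

Record rifs_axioms : Prop := {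
  nodex_incr : forall k l : 'I_N.+1, (k < l)%N -> nodex w k < nodex w l;
  nodex_equi : forall n, Ilen n = mesh;
  uidx_lt_vidx : forall n, (uidx w n < vidx w n)%N;
  Lmap_contractive : forall n, `|slope w n| < 1;
  Lmap_bij : forall n, set_bij (Dset n) (Iset n) (Lmap n);
  Sf_continuous : forall n, {within Dset n, continuous (Sf w n)};
  qf_continuous : forall n, {within Dset n, continuous (qf w n)};
  Sf_BV : forall n,
    bounded_variation (nodex w (uidx w n)) (nodex w (vidx w n)) (Sf w n);
  qf_BV : forall n,
    bounded_variation (nodex w (uidx w n)) (nodex w (vidx w n)) (qf w n);
  Sf_lt1 : forall n t, Dset n t -> `|Sf w n t| < 1;
  Wmap_ends : forall n,
    Wmap n @` [set node (uidx w n); node (vidx w n)]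
    = [set node (lidx n); node (ridx n)] }.

(* There is an edge from j to i. *)
Definition edge : rel 'I_N := fun j i => `[< Iset j `<=` Dset i >].

(* The path is j :: p, and p <> [::] expresses that it has at least one
   edge. *)
Definition has_path_in V j i : Prop :=
  exists p : seq 'I_N,
    [/\ p <> [::], path edge j p, last j p = i & {subset j :: p <= V}].

Definition strongly_connected V : Prop :=
  V != finset.set0 /\ (forall i j, i \in V -> j \in V -> has_path_in V j i).

Definition strong_component V : Prop :=
  strongly_connected V /\
  (forall V' : {set 'I_N}, V \subset V' -> strongly_connected V' -> V' = V).

Section Component.
Context (La : {set 'I_N}) (T : nat).

Fixpoint Bset (k : nat) : set R :=
  match k with
  | 0 => \bigcup_(n in [set` La]) Dset n
  | k'.+1 => \bigcup_(n in [set` La]) (Lmap n @` (Bset k' `&` Dset n))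
  end.

Definition Kset : set R := \bigcap_(k in [set: nat]) Bset k.

Fixpoint Bfam (k : nat) : set (set R) :=
  match k with
  | 0 => [set E | exists2 n, n \in La & E = Dset n]
  | k'.+1 => [set E | exists n F,
      [/\ n \in La, Bfam k' F, F `<=` Dset n & E = Lmap n @` F]]
  end.

Lemma block_subproof (d p : nat) (i : 'I_(d * p)) : (i %/ p < d)%N.
Proof.
case: p i => [|p] i; first by case: i => m; rewrite muln0.
by rewrite ltn_divLR.
Qed.

Definition block (d p : nat) (i : 'I_(d * p)) : 'I_d :=
  Ordinal (block_subproof i).

(* The level-k indices (k >= 1) also start from 0: the index t * T^(k-1) + j,
   with t < d_r and j < T^(k-1), is the j-th subinterval of the interval of
   index a_(r,t). *)
Notation idx k := 'I_(#|La| * T ^ k.-1).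

(* enum lists 'I_N increasingly, so enum_val t is the t-th smallest element of
   La. For T >= 1, owner i is the unique n with Ik i `<=` Iset n. *)
Definition owner k (i : idx k) : 'I_N := enum_val (block i).

Definition Ik k (i : idx k) : set R :=
  let h := mesh / (T ^ k.-1)%:R in
  let l := nodex w (lidx (owner i)) + (i %% T ^ k.-1)%:R * h in
  `[l, l + h]%classic.

Definition Theta k : {set idx k} :=
  [set i : idx k | `[< Bfam k (Ik i) >]]%SET.

Definition Dk k (i : idx k) : set R :=
  Dset (owner i) `&` Lmap (owner i) @^-1` Ik i.

(* The functions |S_n| are continuous on the compact sets Ik j `<=` Dset n
   which occur, so sup and inf are a maximum and a minimum. *)
Definition Mup k : 'M[R]_(#|La| * T ^ k.-1) :=
  \matrix_(i, j) (if `[< Ik j `<=` Dk i >]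
                  then sup [set `|Sf w (owner i) t| | t in Ik j] else 0).

Definition Mlow k : 'M[R]_(#|La| * T ^ k.-1) :=
  \matrix_(i, j) (if `[< Ik j `<=` Dk i >]
                  then inf [set `|Sf w (owner i) t| | t in Ik j] else 0).

Definition rho_up k : R := spectral_radius (restrict_mx (Mup k) (Theta k)).

Definition rho_low k : R := spectral_radius (restrict_mx (Mlow k) (Theta k)).

End Component.
End Rifs.

(* Main.v *)
(* Elements of B_(r,k), k >= 1, are coded by walks n_1 ... n_k in the component
   with I_(n_(l+1)) contained in D_(n_l): the walk s = n_1 ... n_k codes the
   cell L_(n_1) ... L_(n_(k-1)) (I_(n_k)), and an (i, j) entry of the restricted
   matrices is not forced to vanish exactly when the walk of i is the length-k
   prefix of n s, where s is the walk of j and n s is again a walk. So the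
   matrices are transfer operators of a subshift of finite type.

   For a nonnegative matrix B, the spectral radius is the infimum of the lam such
   that u B <= lam u for some positive row vector u. Such vectors pass between
   levels: a solution u for the maxima at level k gives s |-> u (prefix of s) at
   level k + 1, and a solution u for the minima at level k + 1 gives
   s |-> min_m u (s m) at level k, because the predecessors of s m and of s are in
   bijection. If S_n > 0 on K_r, then by compactness the ratio max/min of |S_n|
   over the cells tends to 1 uniformly, so that for every a > 1 the radius of the
   maxima is eventually at most a times the radius of the minima. *)
Require Import Defs.
From HB Require Import structures.
From mathcomp Require Import all_boot all_order all_algebra.
From mathcomp Require Import complex polyrcf ring lra zify.
From mathcomp Require Import all_classical all_reals all_analysis.

Set Implicit Arguments.
Unset Strict Implicit.
Unset Printing Implicit Defensive.

Import Order.TTheory GRing.Theory Num.Theory.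
Import numFieldNormedType.Exports.
Local Open Scope classical_set_scope.
Local Open Scope ring_scope.

(** * Nonnegative matrices *)

Section NonnegativeMatrix.
Context {R : realType}.
Implicit Types (p : nat).

Let nc := @ComplexField.Normc.normc R.

Let nc_ge0 (z : R[i]) : 0 <= nc z.
Proof. by case: z => a b; exact: sqrtr_ge0. Qed.

Let ncD (y z : R[i]) : nc (y + z) <= nc y + nc z.
Proof. exact: le_normcD. Qed.

Let nc_real (x : R) : nc (real_complex R x) = `|x|.
Proof. by rewrite /nc /= expr0n /= addr0 sqrtr_sqr. Qed.

Let nc_sum (I : finType) (F : I -> R[i]) : nc (\sum_i F i) <= \sum_i nc (F i).
Proof.
elim/big_rec2: _ => [|i y z _ h]; first by rewrite /nc ComplexField.Normc.normc0.
by rewrite (le_trans (ncD _ _))// lerD2l.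
Qed.

(** For a left eigenvector [v], pick [j] maximizing [F j], that is |v_j| / u_j. Coordinate j of v B
    = z v, with |v_i| <= F_j u_i, gives |z| F_j u_j <= lam F_j u_j, and F_j u_j > 0. *)
Lemma eigenvalue_le_super p (B : 'M[R]_p) (u : 'I_p -> R) (lam : R) (z : R[i]) :
  (forall i j, 0 <= B i j) -> (forall i, 0 < u i) ->
  (forall j, \sum_i u i * B i j <= lam * u j) ->
  eigenvalue (map_mx (real_complex R) B) z ->
  ComplexField.Normc.normc z <= lam.
Proof.
move=> B0 u0 uB /eigenvalueP[v vB v0].
have [i0 vi0] : exists i, v 0 i != 0 by exact/rV0Pn.
pose F i := nc (v 0 i) / u i.
have [j _ Fj] := @arg_maxP _ _ _ i0 xpredT F isT.
have vle i : nc (v 0 i) <= F j * u i.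
  by rewrite -ler_pdivrMr//; exact: (Fj i isT).
have Fj0 : 0 < F j.
  apply: lt_le_trans (Fj i0 isT); rewrite divr_gt0// lt_neqAle nc_ge0 andbT eq_sym.
  by apply: contra_neq vi0; exact: ComplexField.Normc.eq0_normc.
have : nc (z * v 0 j) <= F j * (lam * u j).
  have -> : z * v 0 j = \sum_i v 0 i * real_complex R (B i j).
    by move/matrixP: vB => /(_ 0 j); rewrite !mxE => <-; apply: eq_bigr => i _; rewrite mxE.
  apply: (le_trans (nc_sum _)); apply: (@le_trans _ _ (\sum_i F j * (u i * B i j))).
    apply: ler_sum => i _.
    by rewrite /nc ComplexField.Normc.normcM -/nc nc_real (ger0_norm (B0 _ _)) mulrA ler_wpM2r.
  by rewrite -mulr_sumr ler_wpM2l// ltW.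
rewrite /nc ComplexField.Normc.normcM -/nc.
have -> : nc (v 0 j) = F j * u j by rewrite /F divfK// gt_eqF.
by rewrite mulrCA ler_pM2l// ler_pM2r.
Qed.

Lemma spectral_radius_le_super p (B : 'M[R]_p) (u : 'I_p -> R) (lam : R) :
  (forall i j, 0 <= B i j) -> 0 <= lam -> (forall i, 0 < u i) ->
  (forall j, \sum_i u i * B i j <= lam * u j) ->
  spectral_radius B <= lam.
Proof.
move=> B0 lam0 u0 uB; rewrite /spectral_radius.
set S := (X in sup X); have [->|/set0P S0] := eqVneq S set0; first by rewrite sup0.
by apply: ge_sup => // _ [z zB <-]; exact: eigenvalue_le_super uB zB.
Qed.

(** [sup] is a default value on unbounded sets, so a bound is exhibited: the constant vector 1 is a
    supersolution for the sum of all entries. *)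
Lemma has_ubound_eigenvalues p (B : 'M[R]_p) : (forall i j, 0 <= B i j) ->
  has_ubound [set ComplexField.Normc.normc z
    | z in [set z : R[i] | eigenvalue (map_mx (real_complex R) B) z]].
Proof.
move=> B0; exists (\sum_j \sum_i B i j) => _ [z zB <-].
apply: (@eigenvalue_le_super _ B (fun=> 1)) zB => // j.
under eq_bigr do rewrite mul1r.
by rewrite mulr1 [leRHS](bigD1 j)//= lerDl sumr_ge0// => i _; rewrite sumr_ge0.
Qed.

Lemma spectral_radius_ge0 p (B : 'M[R]_p) : (forall i j, 0 <= B i j) ->
  0 <= spectral_radius B.
Proof.
move=> B0; rewrite /spectral_radius.
set S := (X in sup X); have [->|/set0P[x Sx]] := eqVneq S set0.
  by rewrite sup0.
case: (Sx) => z _ zx; apply: (@le_trans _ _ x); first by rewrite -zx nc_ge0.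
by apply: ub_le_sup => //; exact: has_ubound_eigenvalues.
Qed.

Lemma real_eigenvalue_le p (B : 'M[R]_p) (s : R) : (forall i j, 0 <= B i j) ->
  eigenvalue B s -> s <= spectral_radius B.
Proof.
move=> B0 sB; rewrite (le_trans (ler_norm s))// -nc_real.
apply: ub_le_sup; first exact: has_ubound_eigenvalues.
by exists (real_complex R s) => //=; rewrite eigenvalue_map.
Qed.

(* With q the characteristic polynomial and f_j the column sums of
   adj(X - B), Cramer's rule reads s f_j(s) = q(s) + sum_i f_i(s) B_ij. As q > 0
   beyond the spectral radius, f(s) >= 0 forces f(s) > 0, so that positivity,
   clear for large s, propagates down to the spectral radius. *)
Lemma spectral_radius_lt_super p (B : 'M[R]_p) (lam : R) :
  (forall i j, 0 <= B i j) -> spectral_radius B < lam ->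
  exists u : 'I_p -> R, (forall i, 0 < u i) /\
    forall j, \sum_i u i * B i j <= lam * u j.
Proof.
move=> B0 hlam; set rho := spectral_radius B in hlam.
have rho0 : 0 <= rho := spectral_radius_ge0 B0.
pose q := char_poly B.
pose f j : {poly R} := \sum_i \adj (char_poly_mx B) i j.
have cramer s j : s * (f j).[s] = q.[s] + \sum_i (f i).[s] * B i j.
  have : \sum_i \sum_k \adj (char_poly_mx B) i k * char_poly_mx B k j = q.
    have H i : \sum_k \adj (char_poly_mx B) i k * char_poly_mx B k j = q *+ (i == j).
      by move/matrixP: (mul_adj_mx (char_poly_mx B)) => /(_ i j); rewrite !mxE.
    rewrite (eq_bigr _ (fun i _ => H i)) (bigD1 j)//= eqxx big1 ?addr0// => i /negPf ->.
    by rewrite mulr0n.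
  rewrite exchange_big /= => qE.
  have -> : q.[s] = \sum_k (f k).[s] * (char_poly_mx B k j).[s].
    by rewrite -qE horner_sum; apply: eq_bigr => k _; rewrite -mulr_suml hornerM.
  rewrite -big_split /= (bigD1 j)//= big1 ?addr0.
    by rewrite !mxE eqxx mulr1n hornerD hornerN hornerX hornerC; ring.
  move=> i ij; rewrite !mxE (negPf ij) mulr0n sub0r hornerN hornerC; ring.
(* [q] is monic, hence positive far out; q(s) <= 0 would force a real root at or beyond [s], a real
   eigenvalue exceeding [rho]. *)
have q_gt0 s : rho < s -> 0 < q.[s].
  move=> rs; rewrite ltNge; apply/negP => qs.
  have [b hb] := monic_Cauchy_bound (char_poly_monic B).
  have /andP[sb bb] : (s <= Num.max s b) && (b <= Num.max s b).
    by rewrite !le_max !lexx orbT.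
  have [|x /andP[sx _]] := poly_ivt (p := q) sb; first by rewrite qs ltW// hb.
  rewrite -eigenvalue_root_char => /(real_eigenvalue_le B0) xr.
  by move: (lt_le_trans rs (le_trans sx xr)); rewrite ltxx.
have pos s : rho < s -> (forall j, 0 <= (f j).[s]) -> forall j, 0 < (f j).[s].
  move=> rs fs j; have s0 := le_lt_trans rho0 rs.
  rewrite -(pmulr_rgt0 _ s0) cramer ltr_wpDr ?q_gt0// sumr_ge0// => i _.
  exact: mulr_ge0.
(* [s0] exceeds [lam] and every column sum. A negative minimum f_k(s0) would then give s0 f_k <
   sum_i f_i B_ik, against [cramer] and q(s0) > 0. *)
pose s0 := Num.max lam (\sum_i \sum_j B i j) + 1.
have lam_s0 : lam < s0 by rewrite ltr_pwDr// le_max lexx.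
have fs0 j : 0 < (f j).[s0].
  have rs0 := lt_trans hlam lam_s0.
  apply: pos => // {}j; have [k _ kmin] := @arg_minP _ _ _ j xpredT (fun i => (f i).[s0]) isT.
  apply: le_trans (kmin j isT); rewrite leNgt; apply/negP => fk.
  have : (f k).[s0] * \sum_i B i k <= \sum_i (f i).[s0] * B i k.
    by rewrite mulr_sumr ler_sum// => i _; rewrite ler_wpM2r ?kmin.
  have : \sum_i B i k < s0.
    rewrite ltr_pwDr// le_max; apply/orP; right; apply: ler_sum => i _.
    by rewrite [leRHS](bigD1 k)//= lerDl sumr_ge0.
  rewrite -(ltr_nM2l fk) => h1 h2; move: (lt_le_trans h1 h2).
  by rewrite mulrC cramer gtrDr ltNge ltW ?q_gt0.
(* At the last root of [P] in ]rho, s0[ every f_j would still be nonnegative by the intermediate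
   value theorem, hence positive by [pos]; so there is no such root. *)
pose P := \prod_j f j.
have PE s : P.[s] = \prod_j (f j).[s] by rewrite horner_prod.
have P0 : P != 0.
  apply/eqP => P0; have : 0 < P.[s0] by rewrite PE prodr_gt0.
  by rewrite P0 horner0 ltxx.
have fpos s : rho < s -> s < s0 -> {in `]s, s0[, forall x, ~~ root P x} ->
    forall j, 0 <= (f j).[s].
  move=> rs ss0 nr j; rewrite leNgt; apply/negP => fs.
  have [|x /andP[sx xs] fx] := poly_ivt (p := f j) (ltW ss0).
    by rewrite (ltW fs) (ltW (fs0 j)).
  have sx' : s < x.
    by rewrite lt_neqAle sx andbT; apply: contraTneq fx => <-; rewrite /root lt_eqF.
  have xs' : x < s0.
    by rewrite lt_neqAle xs andbT; apply: contraTneq fx => ->; rewrite /root gt_eqF.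
  move: (nr x); rewrite in_itv /= sx' xs' => /(_ isT) /negP; apply.
  by rewrite /root PE (bigD1 j)//= (rootP fx) mul0r.
suff nr : {in `]rho, s0[, forall x, ~~ root P x}.
  exists (fun i => (f i).[lam]); split => [|j].
    apply: pos => //; apply: fpos => // x; rewrite in_itv /= => /andP[xl xs].
    by apply: nr; rewrite in_itv /= xs (lt_trans hlam xl).
  by rewrite cramer lerDr ltW// q_gt0.
case: (prev_rootP P rho s0) => [PE0|y _ Py|c _ _ //]; first by rewrite PE0 eqxx in P0.
rewrite in_itv /= => /andP[ry ys] nr.
have : 0 < P.[y] by rewrite PE prodr_gt0// => j _; exact: pos ry (fpos y ry ys nr) j.
by rewrite Py ltxx.
Qed.

End NonnegativeMatrix.

(** * Walks and cells *)

Section Cells.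
Context {R : realType} {N : nat} (w : rifs R N) (hw : rifs_axioms w).
Implicit Types (n m : 'I_N) (s q : seq 'I_N) (E F : set R).

(** Adjacent intervals I_n share an endpoint, so a subset needs two distinct points to determine its
    interval. *)
Definition nontrivial E := exists x y : R, [/\ x != y, E x & E y].

(** Intersecting with [Dset] makes sense of every sequence, and the base [setT] gives the word
    [[:: n]] the cell I_n. *)
Definition cell s : set R :=
  foldr (fun n E => Lmap w n @` (Dset w n `&` E)) setT s.

Lemma nodexE (k : 'I_N.+1) : nodex w k = nodex w ord0 + k%:R * mesh w.
Proof.
case: k => k; elim: k => [|k IH] hk.
  by rewrite mul0r addr0; congr nodex; exact: val_inj.
have kN : (k < N)%N by [].
have := nodex_equi hw (Ordinal kN); rewrite /Ilen.
have -> : ridx (Ordinal kN) = Ordinal hk by apply: val_inj.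
have -> : lidx (Ordinal kN) = Ordinal (ltnW hk) by apply: val_inj.
by rewrite IH /= => /eqP; rewrite subr_eq => /eqP ->; rewrite -natr1; ring.
Qed.

Lemma Iset_leftE n : nodex w (lidx n) = nodex w ord0 + n%:R * mesh w.
Proof. by rewrite nodexE. Qed.

Lemma Iset_rightE n : nodex w (ridx n) = nodex w ord0 + n.+1%:R * mesh w.
Proof. by rewrite nodexE. Qed.

Lemma mesh_gt0 n : 0 < mesh w.
Proof.
by rewrite -(nodex_equi hw n) subr_gt0; apply: (nodex_incr hw); rewrite /= ltnS.
Qed.

(** First coordinates of [Wmap_ends]; the two cases are the two orientations of L_n. *)
Lemma Lmap_ends n :
  Lmap w n (nodex w (uidx w n)) = nodex w (lidx n) /\
  Lmap w n (nodex w (vidx w n)) = nodex w (ridx n) \/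
  Lmap w n (nodex w (uidx w n)) = nodex w (ridx n) /\
  Lmap w n (nodex w (vidx w n)) = nodex w (lidx n).
Proof.
have /seteqP[sub sup] := Wmap_ends hw n.
have lr : nodex w (lidx n) != nodex w (ridx n).
  by rewrite Iset_leftE Iset_rightE -natr1 lt_eqF// ltrD2l ltr_pM2r ?(mesh_gt0 n)// ltrDl.
have [z [] -> [zl _]] := sup (node w (lidx n)) (or_introl erefl);
have [z' [] -> [z'r _]] := sup (node w (ridx n)) (or_intror erefl).
all: move: lr; rewrite -?zl -?z'r /= ?eqxx // => _; by [left|right].
Qed.

(** A zero slope would make the ends of I_n coincide. Injectivity on the whole line allows
    cancelling L_n in inclusions between images. *)
Lemma Lmap_inj n : injective (Lmap w n).
Proof.
have s0 : slope w n != 0.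
  apply: contraTneq (mesh_gt0 n) => s0; rewrite -(nodex_equi hw n) /Ilen.
  by case: (Lmap_ends n) => -[]; rewrite /Lmap s0 !mul0r => <- <-; rewrite subrr ltxx.
by move=> x y /addIr /(mulfI s0).
Qed.

Lemma Lmap_Iset n : Lmap w n @` Dset w n = Iset w n.
Proof. by have [LD _ ?] := Lmap_bij hw n; apply/seteqP; split => // _ [x Dx <-]; exact: LD. Qed.

Lemma Iset_nontrivial n : nontrivial (Iset w n).
Proof.
exists (nodex w (lidx n)), (nodex w (ridx n)).
have lr : nodex w (lidx n) < nodex w (ridx n).
  by apply: (nodex_incr hw); rewrite /= ltnS.
by rewrite lt_eqF// /Iset /= !in_itv /= !lexx ltW.
Qed.

Lemma nontrivial_lt E : nontrivial E -> exists x y : R, [/\ x < y, E x & E y].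
Proof.
move=> [x [y [xy Ex Ey]]]; have [?|?|/eqP] := ltgtP x y; last by rewrite (negPf xy).
  by exists x, y.
by exists y, x.
Qed.

(** In units of the mesh, two points x < y common to both intervals give n < m + 1 and m < n + 1. *)
Lemma nontrivial_Iset_inj E n m : nontrivial E -> E `<=` Iset w n ->
  E `<=` Iset w m -> n = m.
Proof.
move=> /nontrivial_lt[x [y [xy Ex Ey]]] En Em.
have := (En _ Ex, En _ Ey, Em _ Ex, Em _ Ey); rewrite /Iset /= !in_itv /=.
move=> [[[/andP[n1 _] /andP[_ n2]] /andP[m1 _]] /andP[_ m2]].
have := (le_lt_trans n1 (lt_le_trans xy m2), le_lt_trans m1 (lt_le_trans xy n2)).
rewrite !Iset_leftE !Iset_rightE !ltrD2l !ltr_pM2r ?(mesh_gt0 n)// !ltr_nat => -[a b].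
by apply: val_inj => /=; lia.
Qed.

(** The ends of I_n and D_m are grid points, so meeting in two points forces all of I_n into D_m.
    Inclusions of small cells thus become edges. *)
Lemma nontrivial_edge E n m : nontrivial E -> E `<=` Iset w n ->
  E `<=` Dset w m -> edge w n m.
Proof.
move=> /nontrivial_lt[x [y [xy Ex Ey]]] En Em; apply/asboolP.
have := (En _ Ex, En _ Ey, Em _ Ex, Em _ Ey); rewrite /Iset /Dset /= !in_itv /=.
move=> [[[/andP[n1 _] /andP[_ n2]] /andP[m1 _]] /andP[_ m2]].
have h := mesh_gt0 n.
have := (le_lt_trans n1 (lt_le_trans xy m2), le_lt_trans m1 (lt_le_trans xy n2)).
rewrite Iset_leftE Iset_rightE (nodexE (uidx _ _)) (nodexE (vidx _ _)).
rewrite !ltrD2l !ltr_pM2r// !ltr_nat => -[a b].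
move=> z /=; rewrite !in_itv /= => /andP[z1 z2]; apply/andP; split.
  by apply: le_trans z1; rewrite lerD2l ler_pM2r// ler_nat.
by apply: (le_trans z2); rewrite lerD2l ler_pM2r// ler_nat.
Qed.

Lemma cell_cons_sub n q : cell (n :: q) `<=` Iset w n.
Proof. by rewrite -Lmap_Iset; apply: image_subset => x []. Qed.

Lemma cell1 n : cell [:: n] = Iset w n.
Proof. by rewrite /= setIT Lmap_Iset. Qed.

Lemma cell_take_sub s k : cell s `<=` cell (take k s).
Proof.
elim: s k => [|n s IH] [|k] //=.
by apply: image_subset; apply: setIS; exact: IH.
Qed.

Context (La : {set 'I_N}).

(** Edges run against the reading order: consecutive letters a, b satisfy that I_b lies in D_a, so
    that L_a can be applied after L_b. *)
Definition walk s := all (mem La) s && sorted (fun a b => edge w b a) s.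

Lemma walk_behead n q : walk (n :: q) -> walk q.
Proof. by rewrite /walk => /andP[/= /andP[_ ->] /path_sorted]. Qed.

Lemma walk_mem n q : walk (n :: q) -> n \in La.
Proof. by move=> /andP[/= /andP[]]. Qed.

Lemma walk_cons n m q :
  walk (n :: m :: q) = [&& n \in La, edge w m n & walk (m :: q)].
Proof. by rewrite /walk /= -!andbA; do !bool_congr. Qed.

Lemma walk_take k s : walk s -> walk (take k s).
Proof.
move=> /andP[sLa ss]; rewrite /walk take_sorted// andbT.
by apply/allP => n /mem_take; apply/allP.
Qed.

Lemma cell_sub_Dset n m q : walk (n :: m :: q) -> cell (m :: q) `<=` Dset w n.
Proof.
by rewrite walk_cons => /and3P[_ /asboolP mn _]; apply: subset_trans mn; exact: cell_cons_sub.
Qed.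

Lemma cell_consE n m q : walk (n :: m :: q) ->
  cell (n :: m :: q) = Lmap w n @` cell (m :: q).
Proof. by move=> nw; rewrite {1}/cell /= setIidr//; exact: cell_sub_Dset nw. Qed.

Lemma cell_nontrivial n q : walk (n :: q) -> nontrivial (cell (n :: q)).
Proof.
elim: q n => [|m q IH] n nq; first by rewrite cell1; exact: Iset_nontrivial.
have [x [y [xy Ex Ey]]] := IH _ (walk_behead nq).
by exists (Lmap w n x), (Lmap w n y); rewrite (inj_eq (@Lmap_inj n)) cell_consE//.
Qed.

(** The cell of [s] lies in the intervals of both first letters, so these agree; injectivity of L_n
    strips them off and the tails are compared. *)
Lemma cell_sub_take s q : walk s -> (size q <= size s)%N ->
  cell s `<=` cell q -> q = take (size q) s.
Proof.
elim: q s => [|m q IH] [|n s] //= sw qs sq.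
have nm : n = m.
  apply: (@nontrivial_Iset_inj (cell (n :: s))); first exact: cell_nontrivial.
    exact: cell_cons_sub.
  by apply: subset_trans sq _; exact: (@cell_cons_sub m q).
subst m; congr (_ :: _).
case: s sw qs sq => [|m s] sw qs sq; first by case: q qs {IH sq}.
apply: IH; [exact: walk_behead sw|exact: qs|move=> x sx].
have [|y [_ qy] /Lmap_inj <- //] := sq (Lmap w n x).
by exists x => //; split => //; exact: cell_sub_Dset sx.
Qed.

(** With [n :: q] the word of row i and [s] that of column j, the left side is the condition
    governing the entry (i, j) of the matrices. *)
Lemma cell_sub_preimage n q s : walk (n :: q) -> s != [::] -> walk s ->
  size s = size (n :: q) ->
  (cell s `<=` Dset w n `&` Lmap w n @^-1` cell (n :: q)) <->
  walk (n :: s) /\ n :: q = take (size s) (n :: s).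
Proof.
case: s => // m s nq _ sw; rewrite /= => -[sz]; split=> [h|[ns [->]]].
- have hD : cell (m :: s) `<=` Dset w n by move=> x /h[].
  have ns : walk (n :: m :: s).
    rewrite walk_cons sw andbT (walk_mem nq) /=.
    exact: nontrivial_edge (cell_nontrivial sw) (@cell_cons_sub _ _) hD.
  split => //; congr (_ :: _); rewrite sz; apply: cell_sub_take => //=.
    by rewrite -sz.
  by move=> x /h[_ [y [_ ?] /Lmap_inj <-]].
- move=> x sx; have Dx := cell_sub_Dset ns sx.
  by split => //; exists x => //; split => //; exact: (@cell_take_sub (m :: s) (size s)).
Qed.

End Cells.

(** * Numbering of the cells *)

Lemma image_affine_itv {R : realFieldType} (s o a b : R) : 0 < s ->
  (fun x => s * x + o) @` `[a, b] = `[s * a + o, s * b + o]%classic.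
Proof.
move=> s0; apply/seteqP; split=> [_ [x + <-]|y] /=; rewrite !in_itv /=.
  by rewrite !lerD2r !ler_pM2l.
move=> /andP[ay yb]; exists ((y - o) / s); last by rewrite mulrC divfK ?subrK// gt_eqF.
by rewrite /= in_itv /= ler_pdivlMr// ler_pdivrMr// lerBrDr lerBlDr !(mulrC _ s) ay yb.
Qed.

Lemma image_affine_itvN {R : realFieldType} (s o a b : R) : s < 0 ->
  (fun x => s * x + o) @` `[a, b] = `[s * b + o, s * a + o]%classic.
Proof.
move=> s0; apply/seteqP; split=> [_ [x + <-]|y] /=; rewrite !in_itv /=.
  by rewrite !lerD2r !ler_nM2l// andbC.
move=> /andP[ay yb]; exists ((y - o) / s); last by rewrite mulrC divfK ?subrK// lt_eqF.
by rewrite /= in_itv /= ler_ndivlMr// ler_ndivrMr// lerBrDr lerBlDr !(mulrC _ s) ay yb.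
Qed.

Section Indexing.
Context {R : realType} {N : nat} (w : rifs R N) (hw : rifs_axioms w).
Context (La : {set 'I_N}) (T : nat) (T_gt0 : (0 < T)%N).
Context (ratio : forall n, n \in La -> Dlen w n / Ilen w n = T%:R).
Implicit Types (n m : 'I_N) (s q : seq 'I_N) (E F : set R).

Let T_neq0 : T%:R != 0 :> R. Proof. by rewrite pnatr_eq0 -lt0n. Qed.
Let Tk_neq0 k : (T ^ k)%:R != 0 :> R.
Proof. by rewrite pnatr_eq0 -lt0n expn_gt0 T_gt0. Qed.

Lemma vidxE n : n \in La -> vidx w n = (uidx w n + T)%N :> nat.
Proof.
have h := mesh_gt0 hw n; move=> /ratio e.
have {e} : Dlen w n = T%:R * mesh w by rewrite -e (nodex_equi hw) divfK// gt_eqF.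
rewrite /Dlen (nodexE hw (vidx _ _)) (nodexE hw (uidx _ _)) opprD addrACA subrr add0r -mulrBl.
move=> /(mulIf (lt0r_neq0 h)) /eqP; rewrite subr_eq -natrD eqr_nat addnC.
by move=> /eqP.
Qed.

(** D_n is T times as long as I_n, whence a slope of 1/T or -1/T according to the case of
    [Lmap_ends]. *)
Lemma slopeE n : n \in La ->
  slope w n = T%:R^-1 /\
    Lmap w n (nodex w (uidx w n)) = nodex w (lidx n) \/
  slope w n = - T%:R^-1 /\
    Lmap w n (nodex w (uidx w n)) = nodex w (ridx n).
Proof.
move=> nLa; have h := mesh_gt0 hw n; have h0 := lt0r_neq0 h.
have Dl : nodex w (vidx w n) = nodex w (uidx w n) + T%:R * mesh w.
  by rewrite (nodexE hw (vidx _ _)) vidxE// (nodexE hw (uidx _ _)) natrD; ring.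
have Il : nodex w (ridx n) = nodex w (lidx n) + mesh w.
  by rewrite -(nodex_equi hw n) /Ilen; ring.
have [[Lu Lv]|[Lu Lv]] := Lmap_ends hw n; [left|right]; split => //.
all: move: Lv; rewrite Dl {1}/Lmap mulrDr addrAC -/(Lmap w n _) Lu Il.
- move=> /addrI e; apply: (mulIf h0); apply: (mulIf T_neq0).
  by rewrite -mulrA (mulrC (mesh w)) e; field.
- move=> e; apply: (mulIf h0); apply: (mulIf T_neq0).
  have {}e : slope w n * (T%:R * mesh w) = - mesh w.
    by apply: (addrI (nodex w (lidx n) + mesh w)); rewrite e addrK.
  by rewrite -mulrA (mulrC (mesh w)) e; field.
Qed.

(* The g-th (from 0) of the T^k equal parts of I_n. *)
Definition subcell k n (g : nat) : set R :=
  let h := mesh w / (T ^ k)%:R in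
  let l := nodex w (lidx n) + g%:R * h in `[l, l + h]%classic.

(** In units of the width, the left end is n T^k + g steps from x_0; Euclidean division by T^k
    recovers n and g. *)
Lemma subcell_inj k n m g g' : (g < T ^ k)%N -> (g' < T ^ k)%N ->
  subcell k n g = subcell k m g' -> n = m /\ g = g'.
Proof.
move=> gT gT'; rewrite /subcell; set h := mesh w / _.
have h0 : 0 < h by rewrite divr_gt0 ?(mesh_gt0 hw n)// ltr0n expn_gt0 T_gt0.
set l := _ + _ * h; set l' := _ + _ * h => /seteqP[ll' l'l].
have {ll' l'l} : l = l'.
  apply/le_anti/andP; split.
    have : `[l, l + h]%classic l' by apply: l'l; rewrite /= in_itv /= lexx lerDl ltW.
    by rewrite /= in_itv /= => /andP[].
  have : `[l', l' + h]%classic l by apply: ll'; rewrite /= in_itv /= lexx lerDl ltW.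
  by rewrite /= in_itv /= => /andP[].
rewrite /l /l' !(Iset_leftE hw).
have mE : mesh w = (T ^ k)%:R * h by rewrite mulrC divfK.
clearbody h; rewrite mE !mulrA -!addrA -!mulrDl => /addrI.
move/(mulIf (lt0r_neq0 h0))/eqP; rewrite -!natrM -!natrD eqr_nat => /eqP e; split.
  apply: val_inj => /=; have := congr1 (fun x => x %/ T ^ k)%N e.
  by rewrite !divnMDl ?expn_gt0 ?T_gt0// !divn_small// !addn0.
by have := congr1 (fun x => x %% T ^ k)%N e; rewrite !modnMDl !modn_small.
Qed.

Lemma edge_uidx n m : n \in La -> edge w m n ->
  (uidx w n <= m)%N /\ (m < uidx w n + T)%N.
Proof.
move=> nLa /asboolP mn; have h := mesh_gt0 hw n.
have lr : nodex w (lidx m) < nodex w (ridx m).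
  by apply: (nodex_incr hw); rewrite /= ltnS.
have : Dset w n (nodex w (lidx m)).
  by apply: mn; rewrite /Iset /= in_itv /= lexx ltW.
have : Dset w n (nodex w (ridx m)).
  by apply: mn; rewrite /Iset /= in_itv /= lexx ltW.
rewrite /Dset /= !in_itv /= => /andP[_ +] /andP[+ _].
rewrite (Iset_leftE hw) (Iset_rightE hw) (nodexE hw (uidx _ _)) (nodexE hw (vidx _ _)).
by rewrite !lerD2l !ler_pM2r// !ler_nat vidxE.
Qed.

Lemma Lmap_subcell n m k g : n \in La -> edge w m n -> (g < T ^ k)%N ->
  exists2 g', (g' < T ^ k.+1)%N & Lmap w n @` subcell k m g = subcell k.+1 n g'.
Proof.
move=> nLa mn gT; have [um mv] := edge_uidx nLa mn.
(* [G] is the number of the given part among the T^(k+1) equal parts of D_n. *)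
pose G := ((m - uidx w n) * T ^ k + g)%N.
have GT : (G < T ^ k.+1)%N.
  rewrite /G expnS; apply: (@leq_trans ((m - uidx w n).+1 * T ^ k)).
    by rewrite mulSn addnC ltn_add2r.
  by rewrite leq_mul2r; apply/orP; right; lia.
have GE : G%:R = (m%:R - (uidx w n)%:R) * (T ^ k)%:R + g%:R :> R.
  by rewrite natrD natrM natrB.
pose l := nodex w (lidx m) + g%:R * (mesh w / (T ^ k)%:R).
have lE : l = nodex w (uidx w n) + G%:R * (mesh w / (T ^ k)%:R).
  rewrite /l (Iset_leftE hw) (nodexE hw (uidx _ _)) GE; field; exact: Tk_neq0.
have LE x : Lmap w n (nodex w (uidx w n) + x) =
    Lmap w n (nodex w (uidx w n)) + slope w n * x.
  by rewrite /Lmap; ring.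
have T0 : 0 < T%:R^-1 :> R by rewrite invr_gt0 ltr0n.
have [[sE Lu]|[sE Lu]] := slopeE nLa.
- exists G => //.
  have img a b : Lmap w n @` `[a, b] = `[Lmap w n a, Lmap w n b]%classic.
    by apply: image_affine_itv; rewrite sE.
  rewrite /subcell -/l img lE -addrA !LE Lu sE expnS natrM.
  set h := mesh w; have -> : T%:R^-1 * (G%:R * (h / (T ^ k)%:R)) =
    G%:R * (h / (T%:R * (T ^ k)%:R)) by field; rewrite T_neq0 Tk_neq0.
  rewrite -addrA; set a := G%:R * _; have -> // :
    T%:R^-1 * (G%:R * (h / (T ^ k)%:R) + h / (T ^ k)%:R) =
    a + h / (T%:R * (T ^ k)%:R) by rewrite /a; field; rewrite T_neq0 Tk_neq0.
(* A decreasing L_n reverses the numbering. *)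
- exists (T ^ k.+1 - G.+1)%N; first by rewrite ltn_subrL /= expn_gt0 T_gt0.
  have img a b : Lmap w n @` `[a, b] = `[Lmap w n b, Lmap w n a]%classic.
    by apply: image_affine_itvN; rewrite sE oppr_lt0.
  rewrite /subcell -/l img lE -addrA !LE Lu sE natrB// -[G.+1%:R]natr1 expnS natrM.
  have -> : nodex w (ridx n) = nodex w (lidx n) + mesh w.
    by rewrite -(nodex_equi hw n) /Ilen; ring.
  set h := mesh w; rewrite -!addrA.
  set a := h + _; set b := h + _; set a' := _ * (h / (_ * _)).
  have -> : a = a' by rewrite /a /a'; field; rewrite T_neq0 Tk_neq0.
  by have -> : b = a' + h / (T%:R * (T ^ k)%:R) by
    rewrite /b /a'; field; rewrite T_neq0 Tk_neq0.
Qed.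

Lemma cell_subcell n q : walk w La (n :: q) ->
  exists2 g, (g < T ^ size q)%N & cell w (n :: q) = subcell (size q) n g.
Proof.
elim: q n => [|m q IH] n nq.
  exists 0; first by rewrite expn_gt0 T_gt0.
  rewrite cell1// /subcell expn0 divr1 mul0r addr0.
  by rewrite -(nodex_equi hw n) /Ilen addrC subrK.
have := nq; rewrite walk_cons => /and3P[nLa mn mq].
have [g gT gE] := IH _ mq.
by have [g' ? E] := Lmap_subcell nLa mn gT; exists g' => //; rewrite (cell_consE hw nq) gE.
Qed.

Notation idx k := 'I_(#|La| * T ^ k.-1).

Lemma Ik_subcell k (i : idx k.+1) :
  Ik w i = subcell k (owner i) (i %% T ^ k).
Proof. by []. Qed.

Lemma Ik_inj k : injective (@Ik R N w La T k.+1).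
Proof.
have Tk : (0 < T ^ k)%N by rewrite expn_gt0 T_gt0.
move=> i j; rewrite !Ik_subcell => /subcell_inj.
rewrite !ltn_pmod// => /(_ isT isT)[/enum_val_inj /(congr1 val) /= ij ijm].
by apply: val_inj; rewrite /= (divn_eq i (T ^ k)) (divn_eq j (T ^ k)) ij ijm.
Qed.

Lemma cell_Ik n q k : walk w La (n :: q) -> size q = k ->
  exists i : idx k.+1, Ik w i = cell w (n :: q) /\ owner i = n.
Proof.
move=> nq <-; have nLa := walk_mem nq.
have [g gT gE] := cell_subcell nq.
have iP : (enum_rank_in nLa n * T ^ size q + g < #|La| * T ^ size q)%N.
  apply: (@leq_trans ((enum_rank_in nLa n).+1 * T ^ size q)).
    by rewrite mulSn addnC ltn_add2r.
  by rewrite leq_mul2r ltn_ord orbT.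
have oE : @owner N La T (size q).+1 (Ordinal iP) = n.
  rewrite /owner -[RHS](enum_rankK_in nLa nLa); congr enum_val; apply: val_inj => /=.
  by rewrite divnMDl ?expn_gt0 ?T_gt0// divn_small// addn0.
by exists (Ordinal iP); rewrite Ik_subcell oE gE /= modnMDl modn_small.
Qed.

(** Both have length T times the mesh. Hence the level-1 sets L_n(D_m), with D_m inside D_n, are
    exactly I_n. *)
Lemma Dset_sub_eq n m : n \in La -> m \in La -> Dset w m `<=` Dset w n ->
  Dset w m = Dset w n.
Proof.
move=> nLa mLa sub; have h := mesh_gt0 hw n.
have uv : nodex w (uidx w m) < nodex w (vidx w m).
  exact: (nodex_incr hw) (uidx_lt_vidx hw m).
have : Dset w n (nodex w (uidx w m)).
  by apply: sub; rewrite /Dset /= in_itv /= lexx ltW.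
have : Dset w n (nodex w (vidx w m)).
  by apply: sub; rewrite /Dset /= in_itv /= lexx ltW.
rewrite {1 2}/Dset /= !in_itv /= => /andP[_ +] /andP[+ _].
rewrite !(nodexE hw (uidx _ _)) !(nodexE hw (vidx _ _)).
rewrite !lerD2l !ler_pM2r// !ler_nat !vidxE// leq_add2r => a b.
have u : uidx w m = uidx w n by apply: val_inj; apply/eqP; rewrite eqn_leq a b.
have v : vidx w m = vidx w n by apply: val_inj; rewrite /= !vidxE// u.
by rewrite /Dset u v.
Qed.

(** The coding starts at level 1, since level 0 consists of the D_n. Beyond, [nontrivial_edge] turns
    the inclusion of F in D_n into the edge that prolongs the walk on the left. *)
Lemma Bfam_cell k E : Bfam w La k.+1 E <->
  exists s, [/\ walk w La s, size s = k.+1 & E = cell w s].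
Proof.
elim: k E => [|k IH] E; split.
- move=> [n [F [nLa [m mLa ->] sub ->]]]; exists [:: n]; split => //.
    by rewrite /walk /= nLa.
  by rewrite cell1// (Dset_sub_eq nLa mLa sub) Lmap_Iset.
- move=> [s [nw sz ->]]; case: s nw sz => [|n [|//]] // nw _; exists n, (Dset w n).
  have nLa := walk_mem nw.
  by split => //; [exists n|rewrite cell1// Lmap_Iset].
- move=> [n [F [nLa /IH[[|m q] [//sw sz ->]] sub ->]]].
  have nw : walk w La (n :: m :: q).
    rewrite walk_cons nLa sw andbT /=.
    exact: (nontrivial_edge hw (cell_nontrivial hw sw) (@cell_cons_sub _ _ _ hw m q) sub).
  by exists (n :: m :: q); rewrite (cell_consE hw nw) -sz.
- move=> [s [nw sz ->]]; case: s nw sz => [|n [|m q]] // nw [sz]; exists n, (cell w (m :: q)).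
  split; [exact: walk_mem nw| |exact: cell_sub_Dset nw|exact: (cell_consE hw nw)].
  by apply/IH; exists (m :: q); split => //; [exact: walk_behead nw|rewrite /= sz].
Qed.

Lemma Bfam_sub_Bset k E : Bfam w La k E -> E `<=` Bset w La k.
Proof.
elim: k E => [|k IH] E /=.
  by move=> [n nLa ->] x Dx; exists n.
move=> [n [F [nLa /IH BF FD ->]]] _ [x Fx <-].
by exists n => //; exists x => //; split; [exact: BF|exact: FD].
Qed.

End Indexing.

(** * Superharmonic functions on walks *)

Section Transfer.
Context {R : realType} {N : nat} (w : rifs R N) (hw : rifs_axioms w).
Context (La : {set 'I_N}) (T : nat) (T_gt0 : (0 < T)%N).
Context (ratio : forall n, n \in La -> Dlen w n / Ilen w n = T%:R).
Implicit Types (n m : 'I_N) (s q : seq 'I_N).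

Notation idx k := 'I_(#|La| * T ^ k.-1).
Notation walk := (walk w La).
Notation cell := (cell w).
Notation Theta k := (@Theta R N w La T k).

(** The walk coding the i-th interval; [[::]] is the default outside [Theta]. *)
Definition word k (i : idx k.+1) : seq 'I_N :=
  xget [::] [set s | [/\ walk s, size s = k.+1 & Ik w i = cell s]].

Lemma wordP k (i : idx k.+1) : i \in Theta k.+1 ->
  [/\ walk (word i), size (word i) = k.+1 & Ik w i = cell (word i)].
Proof.
by rewrite inE => /asboolP/(Bfam_cell hw ratio) h; exact: (xgetPex [::] h).
Qed.

Lemma word_owner k (i : idx k.+1) : i \in Theta k.+1 ->
  word i = owner i :: behead (word i).
Proof.
move=> /wordP[]; case: (word i) => // n q nq [sq] iE.
have [i' [i'E <-]] := cell_Ik hw T_gt0 ratio nq sq.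
by have -> : i = i' by apply: (Ik_inj hw T_gt0); rewrite iE i'E.
Qed.

Lemma word_inj k : {in Theta k.+1 &, injective (@word k)}.
Proof.
move=> i j /wordP[_ _ iE] /wordP[_ _ jE] ij; apply: (Ik_inj hw T_gt0).
by rewrite iE jE ij.
Qed.

Lemma word_surj k s : walk s -> size s = k.+1 ->
  exists2 i : idx k.+1, i \in Theta k.+1 & word i = s.
Proof.
case: s => // n q nq [sq]; have [i [iE _]] := cell_Ik hw T_gt0 ratio nq sq.
have iT : i \in Theta k.+1.
  by rewrite inE; apply/asboolP/(Bfam_cell hw ratio); exists (n :: q); rewrite /= sq.
exists i => //; have [iw isz iE'] := wordP iT.
rewrite (cell_sub_take (q := word i) hw nq).
- by rewrite take_oversize// isz /= sq.
- by rewrite isz /= sq.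
- by rewrite -iE -iE'.
Qed.

(** Common form of [Mup] and [Mlow], with [c] the supremum or infimum of |S_n| over a cell. *)
Definition kernel_mx (c : 'I_N -> set R -> R) k : 'M[R]_(#|La| * T ^ k.-1) :=
  \matrix_(i, j) (if `[< Ik w j `<=` Dk w i >] then c (owner i) (Ik w j) else 0).

Lemma Ik_sub_Dk k (i j : idx k.+1) : i \in Theta k.+1 -> j \in Theta k.+1 ->
  (Ik w j `<=` Dk w i) <->
  walk (owner i :: word j) /\ word i = take k.+1 (owner i :: word j).
Proof.
move=> iT jT; have [iw isz iE] := wordP iT; have [jw jsz jE] := wordP jT.
rewrite /Dk jE iE; move: iw isz {iE}; rewrite (word_owner iT) => iw isz.
rewrite (cell_sub_preimage hw iw)//; first by rewrite jsz.
  by case: (word j) jsz.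
exact: etrans jsz (esym isz).
Qed.

(** In column j, the rows not forced to vanish correspond bijectively, through [owner], to the
    letters n that may precede the word of j. *)
Lemma kernel_mx_sum c k (u : seq 'I_N -> R) (j : idx k.+1) : j \in Theta k.+1 ->
  \sum_(i in Theta k.+1) u (word i) * kernel_mx c k.+1 i j =
  \sum_(n | walk (n :: word j)) u (take k.+1 (n :: word j)) * c n (cell (word j)).
Proof.
move=> jT; have [jw jsz jE] := wordP jT.
(* [h] maps a letter n to its row; the value [j] is a filler when [n :: word j] is not a walk. *)
have /choice[h hP] : forall n, exists i : idx k.+1, walk (n :: word j) ->
    [/\ i \in Theta k.+1, word i = take k.+1 (n :: word j) & owner i = n].
  move=> n; have [nw|] := boolP (walk (n :: word j)); last by exists j.
  have [||i iT iE] := @word_surj k (take k.+1 (n :: word j)).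
  - exact: walk_take.
  - by rewrite size_takel//= jsz.
  by exists i => _; split => //; move: iE; rewrite (word_owner iT) => -[].
rewrite (@reindex_onto _ _ _ _ _ (@owner N La T k.+1) h); last by move=> n /hP[].
under [LHS]eq_bigr => i _ do rewrite /kernel_mx mxE (fun_if ( *%R (u (word i)))) mulr0.
rewrite -big_mkcondr /=; apply: eq_big => i.
  apply/andP/andP => -[].
    move=> iT /asboolP/(Ik_sub_Dk iT jT)[iw iE]; split => //.
    have [hT hE _] := hP _ iw; apply/eqP; apply: word_inj => //.
    by rewrite hE iE.
  move=> iw /eqP hi; have := hP _ iw; rewrite hi => -[iT iE _]; split => //.
  by apply/asboolP/(Ik_sub_Dk iT jT).
by move=> /andP[iT /asboolP/(Ik_sub_Dk iT jT)[iw iE]]; rewrite iE jE.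
Qed.

(* The prefixes of length |s| of the walks n s are the predecessors of s, so this
   is positivity of u together with u A <= lam u for the matrix A of level k. *)
Definition superharmonic (c : 'I_N -> set R -> R) k lam (u : seq 'I_N -> R) :=
  (forall s, walk s -> size s = k.+1 -> 0 < u s) /\
  (forall s, walk s -> size s = k.+1 ->
    \sum_(n | walk (n :: s)) u (take k.+1 (n :: s)) * c n (cell s) <= lam * u s).

Lemma spectral_radius_le_superharmonic c k lam u :
  (forall n E, 0 <= c n E) -> 0 <= lam -> superharmonic c k lam u ->
  spectral_radius (restrict_mx (kernel_mx c k.+1) (Theta k.+1)) <= lam.
Proof.
move=> c0 lam0 [u0 uc].
apply: (@spectral_radius_le_super _ _ _ (fun t => u (word (enum_val t)))) => //.
- by move=> i j; rewrite /restrict_mx /kernel_mx !mxE; case: ifP.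
- by move=> t; have [? ? _] := wordP (enum_valP t); exact: u0.
- move=> t; under eq_bigr do rewrite /restrict_mx mxE.
  rewrite -(big_enum_val (fun i => u (word i) * kernel_mx c k.+1 i (enum_val t))).
  rewrite kernel_mx_sum ?enum_valP//.
  by have [? ? _] := wordP (enum_valP t); exact: uc.
Qed.

Lemma spectral_radius_lt_superharmonic c k lam :
  (forall n E, 0 <= c n E) ->
  spectral_radius (restrict_mx (kernel_mx c k.+1) (Theta k.+1)) < lam ->
  exists u, superharmonic c k lam u.
Proof.
move=> c0 /spectral_radius_lt_super[|v [v0 vc]].
  by move=> i j; rewrite /restrict_mx /kernel_mx !mxE; case: ifP.
(* Words being distinct, this sum has one term at each coded walk: it extends [v] to all
   sequences. *)
pose u s := \sum_(t | word (enum_val t) == s) v t.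
have uE t : u (word (enum_val t)) = v t.
  rewrite /u (big_pred1 t)// => t'; rewrite /= (inj_in_eq (@word_inj k)) ?enum_valP//.
  by rewrite (inj_eq enum_val_inj).
have surj s : walk s -> size s = k.+1 -> exists t, s = word (@enum_val _ (mem (Theta k.+1)) t).
  move=> sw ssz; have [i iT <-] := word_surj sw ssz.
  by exists (enum_rank_in iT i); rewrite enum_rankK_in.
exists u; split => s sw ssz; have [t ->] := surj s sw ssz; rewrite uE//.
apply: le_trans (vc t); rewrite -kernel_mx_sum ?enum_valP//.
rewrite (big_enum_val (fun i => u (word i) * kernel_mx c k.+1 i (enum_val t))).
by under [leRHS]eq_bigr => i _ do rewrite /restrict_mx mxE -uE.
Qed.

End Transfer.

(** * Extremal kernels and passage between levels *)

Section Kernels.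
Context {R : realType} {N : nat} (w : rifs R N) (hw : rifs_axioms w).
Context (La : {set 'I_N}).
Implicit Types (n m : 'I_N) (s q : seq 'I_N) (E F : set R).

Notation walk := (walk w La).
Notation cell := (cell w).
Notation superharmonic := (superharmonic w La).

Definition sup_kernel n E : R := sup [set `|Sf w n t| | t in E].
Definition inf_kernel n E : R := inf [set `|Sf w n t| | t in E].

Lemma sup_kernel_ge0 n E : 0 <= sup_kernel n E.
Proof.
rewrite /sup_kernel; set A := (X in sup X).
have [hA|/sup_out -> //] := pselect (has_sup A).
have [x Ax] := hA.1; apply: (@le_trans _ _ x); first by case: Ax => t _ <-.
by apply: ub_le_sup Ax; exact: hA.2.
Qed.

Lemma inf_kernel_ge0 n E : 0 <= inf_kernel n E.
Proof.
rewrite /inf_kernel; set A := (X in inf X).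
have [->|/set0P A0] := eqVneq A set0; first by rewrite inf0.
by apply: lb_le_inf => // _ [t _ <-].
Qed.

Lemma sup_kernel_has_ubound n E : E `<=` Dset w n ->
  has_ubound [set `|Sf w n t| | t in E].
Proof. by move=> ED; exists 1 => _ [t Et <-]; apply/ltW/(Sf_lt1 hw)/ED. Qed.

Lemma inf_kernel_has_lbound n E : has_lbound [set `|Sf w n t| | t in E].
Proof. by exists 0 => _ [t _ <-]. Qed.

Lemma sup_kernel_subset n E F : E !=set0 -> E `<=` F -> F `<=` Dset w n ->
  sup_kernel n E <= sup_kernel n F.
Proof.
move=> [x Ex] EF FD; apply: ge_sup; first by exists `|Sf w n x|, x.
move=> _ [t Et <-]; apply: ub_le_sup; first exact: sup_kernel_has_ubound.
by exists t => //; exact: EF.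
Qed.

Lemma inf_kernel_subset n E F : E !=set0 -> E `<=` F ->
  inf_kernel n F <= inf_kernel n E.
Proof.
move=> [x Ex] EF; apply: lb_le_inf; first by exists `|Sf w n x|, x.
move=> _ [t Et <-]; apply: ge_inf; first exact: inf_kernel_has_lbound.
by exists t => //; exact: EF.
Qed.

Lemma inf_kernel_le_sup n E : E !=set0 -> E `<=` Dset w n ->
  inf_kernel n E <= sup_kernel n E.
Proof.
move=> [x Ex] ED; apply: (@le_trans _ _ `|Sf w n x|).
  by apply: ge_inf; [exact: inf_kernel_has_lbound|exists x].
by apply: ub_le_sup; [exact: sup_kernel_has_ubound|exists x].
Qed.

Lemma sup_kernel_le_inf n E a : 0 < a -> E !=set0 ->
  (forall x y, E x -> E y -> `|Sf w n x| <= a * `|Sf w n y|) ->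
  sup_kernel n E <= a * inf_kernel n E.
Proof.
move=> a0 [z Ez] h; rewrite mulrC -ler_pdivrMr//.
apply: lb_le_inf; first by exists `|Sf w n z|, z.
move=> _ [y Ey <-]; rewrite ler_pdivrMr// mulrC; apply: ge_sup.
  by exists `|Sf w n z|, z.
by move=> _ [x Ex <-]; exact: h.
Qed.

Lemma walk_cell n s : walk (n :: s) -> s != [::] ->
  cell s !=set0 /\ cell s `<=` Dset w n.
Proof.
case: s => // m q nw _; split; last exact: cell_sub_Dset nw.
by have [x [_ [_ Ex _]]] := cell_nontrivial hw (walk_behead nw); exists x.
Qed.

(** Which letters may precede [s] depends only on its first letter, so [s] and its prefix have the
    same predecessors; the smaller cell has the smaller supremum. *)
Lemma superharmonic_sup_refine k lam u : superharmonic sup_kernel k lam u ->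
  superharmonic sup_kernel k.+1 lam (fun s => u (take k.+1 s)).
Proof.
move=> [u0 uc]; split=> s sw ssz.
  by apply: u0; [exact: walk_take|rewrite size_takel// ssz].
have tw := walk_take k.+1 sw.
have tsz : size (take k.+1 s) = k.+1 by rewrite size_takel// ssz.
apply: le_trans (uc _ tw tsz).
have wE n : walk (n :: s) = walk (n :: take k.+1 s).
  by move: sw tw; case: s ssz {tsz} => // m q _; rewrite /= !walk_cons => -> ->.
rewrite (eq_bigl _ _ wE); apply: ler_sum => n nw.
have uE : take k.+1 (take k.+2 (n :: s)) = take k.+1 (n :: take k.+1 s).
  by rewrite take_takel//= take_takel.
have tn0 : take k.+1 s != [::] by rewrite -size_eq0 tsz.
have [_ tD] := walk_cell nw tn0.
have [c0 _] : cell s !=set0 /\ cell s `<=` Dset w n.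
  by apply: walk_cell; rewrite ?wE// -size_eq0 ssz.
rewrite uE ler_wpM2l//.
  apply/ltW/u0; first exact: walk_take.
  by rewrite size_takel//= tsz.
by apply: sup_kernel_subset => //; exact: cell_take_sub.
Qed.

Lemma walk_rcons s m m' : walk (rcons s m) -> edge w m' m -> m' \in La ->
  walk (rcons (rcons s m) m').
Proof.
rewrite /walk => /andP[sLa ss] e mLa; rewrite all_rcons /= mLa sLa /=.
case: s {sLa} ss => [|n s] /=; first by rewrite e.
by move=> ss; rewrite rcons_path ss last_rcons.
Qed.

(** The new function is u(f s), where [f s] is the one-letter prolongation of [s] on the right
    minimizing [u]; [succ] provides prolongations. *)
Lemma superharmonic_inf_coarsen k lam u :
  (forall n, n \in La -> exists2 m, m \in La & edge w m n) ->
  superharmonic inf_kernel k.+1 lam u ->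
  exists u', superharmonic inf_kernel k lam u'.
Proof.
move=> succ [u0 uc].
have /choice[f fP] : forall s, exists fs, walk s -> s != [::] ->
    [/\ size fs = (size s).+1, take (size s) fs = s, walk fs &
        forall m, walk (rcons s m) -> u fs <= u (rcons s m)].
  case/lastP => [|s m]; first by exists [::].
  have [sw|] := boolP (walk (rcons s m)); last by exists [::].
  have mLa : m \in La.
    by move: sw => /andP[/allP + _]; apply; rewrite mem_rcons mem_head.
  have [m' m'La m'm] := succ _ mLa.
  have [m1 m1w m1le] := arg_minP (fun m1 => u (rcons (rcons s m) m1))
    (walk_rcons sw m'm m'La : (fun m1 => walk (rcons (rcons s m) m1)) m').
  exists (rcons (rcons s m) m1) => _ _; split => //; first by rewrite size_rcons.
  by rewrite -[X in take _ X]cats1 take_size_cat.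
exists (u \o f); split=> s sw ssz; have sn0 : s != [::] by rewrite -size_eq0 ssz.
  by have [fsz _ fw _] := fP s sw sn0; apply: u0; rewrite // fsz ssz.
have [fsz ftake fw _] := fP s sw sn0.
apply: le_trans (uc _ fw _); last by rewrite fsz ssz.
have wE n : walk (n :: s) = walk (n :: f s).
  move: sw fw ftake; case: (s) sn0 => // m q _ /=.
  by case: (f _) => // m1 q1 + + /= [m1E _]; rewrite m1E !walk_cons => -> ->.
rewrite (eq_bigl _ _ wE); apply: ler_sum => n nw.
have tE : take k.+2 (n :: f s) = n :: s by rewrite /= -ssz ftake.
have nsw : walk (n :: s) by rewrite wE.
have tsz : size (take k.+1 (n :: s)) = k.+1 by rewrite size_takel//= ssz.
have tn0 : take k.+1 (n :: s) != [::] by rewrite -size_eq0 tsz.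
have tw := walk_take k.+1 nsw.
(* [n :: s] is itself a prolongation of its prefix of length k + 1, so minimality bounds the new
   function at that prefix by u(n s). *)
have nsE : n :: s = rcons (take k.+1 (n :: s)) (last n s).
  have -> : take k.+1 (n :: s) = belast n s.
    by rewrite lastI -cats1 take_size_cat// size_belast ssz.
  exact: lastI.
have [ftsz _ ftw ftle] := fP _ tw tn0.
rewrite tE; apply: ler_pM => /=.
- by apply/ltW/u0 => //; rewrite ftsz tsz.
- exact: inf_kernel_ge0.
- by rewrite [in leRHS]nsE; apply: ftle; rewrite -nsE.
- apply: inf_kernel_subset; last by rewrite -{2}ftake; exact: cell_take_sub.
  by have [] := walk_cell nw; rewrite // -size_eq0 fsz.
Qed.

End Kernels.
(** * Comparison of the radii *)

Section Limit.
Context {R : realType} {N : nat} (w : rifs R N) (hw : rifs_axioms w).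
Context (La : {set 'I_N}) (T : nat) (T_gt1 : (1 < T)%N).
Context (ratio : forall n, n \in La -> Dlen w n / Ilen w n = T%:R).
Context (pred_ex : forall n, n \in La -> exists2 m, m \in La & edge w n m).
Implicit Types (n m : 'I_N) (s q : seq 'I_N).

Notation walk := (walk w La).
Notation cell := (cell w).
Notation Bset := (Bset w La).

(** The base case is that I_n, the image of D_n under L_n, lies in some D_m by [pred_ex]; applying
    the maps L_n propagates it. *)
Lemma Bset_decreasing i j : (i <= j)%N -> Bset j `<=` Bset i.
Proof.
move=> /subnK <-; elim: (j - i)%N => [//|d]; apply: subset_trans; rewrite addSn.
move: (d + i)%N => {j d}i; elim: i => [|i IH] x [n nLa [y [By Dy] <-]].
  have [m mLa /asboolP nm] := pred_ex nLa; exists m => //.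
  by apply: nm; rewrite -(Lmap_Iset hw); exists y.
by exists n => //; exists y => //; split => //; exact: IH.
Qed.

Lemma Bset_compact k : compact (Bset k).
Proof.
have E (F : 'I_N -> set R) :
    \bigcup_(n in [set` La]) F n = \big[setU/set0]_(n <- enum La) F n.
  rewrite -bigcup_seq (_ : [set` enum La] = [set` La])//.
  by apply/seteqP; split => n /=; rewrite mem_enum.
elim: k => [|k IH] /=; rewrite E; apply: bigsetU_compact => n _.
  exact: segment_compact.
apply: continuous_compact; last first.
  apply: (compact_closedI IH); exact: interval_closed.
apply: continuous_subspaceT => x; apply: continuousD; last exact: cst_continuous.
exact: mulrl_continuous.
Qed.

Lemma Bset_closed k : closed (Bset k).
Proof. by apply: compact_closed; [exact: Rhausdorff|exact: Bset_compact]. Qed.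

Lemma cell_sub_Bset k s : walk s -> size s = k.+1 -> cell s `<=` Bset k.+1.
Proof.
by move=> sw ssz; apply: Bfam_sub_Bset; apply/(Bfam_cell hw ratio); exists s.
Qed.

Lemma cell_diameter n q x y : walk (n :: q) ->
  cell (n :: q) x -> cell (n :: q) y ->
  `|x - y| <= mesh w / (T ^ size q)%:R.
Proof.
move=> nq; have [g _ ->] := cell_subcell hw (ltnW T_gt1) ratio nq.
rewrite /subcell /= !in_itv /= => /andP[x1 x2] /andP[y1 y2].
by rewrite ler_norml; apply/andP; split; lra.
Qed.

(* Otherwise there are bad pairs (x_k, y_k) at every level; a cluster point of
   (x_k) lies in K_r, where S_n is positive and continuous, a contradiction. *)
Lemma Sf_oscillation n a : n \in La -> 1 < a ->
  (forall t, (Dset w n `&` Kset w La) t -> 0 < Sf w n t) ->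
  \forall k \near \oo, forall s x y, walk (n :: s) -> size s = k.+1 ->
    cell s x -> cell s y -> `|Sf w n x| <= a * `|Sf w n y|.
Proof.
move=> nLa a1 Spos; apply: contrapT => nb.
(* A bad pair from any level j >= k serves for k, since B_(j+1) lies in B_k and cells shrink with
   j. *)
have {nb} bad k : exists xy : R * R,
    [/\ (Dset w n `&` Bset k) xy.1, Dset w n xy.2,
        `|xy.1 - xy.2| <= mesh w / (T ^ k)%:R &
        a * `|Sf w n xy.2| < `|Sf w n xy.1| ].
  apply: contrapT => nxy; apply: nb; exists k => // j /= kj s x y ns ssz sx sy.
  rewrite leNgt; apply/negP => lt; apply: nxy; exists (x, y).
  have sD : cell s `<=` Dset w n.
    by have [] := walk_cell hw ns; rewrite // -size_eq0 ssz.
  have {ns} sw := walk_behead ns.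
  split => //=; first split; [exact: sD| |exact: sD|].
    by apply: (Bset_decreasing (leqW kj)); exact: (cell_sub_Bset sw ssz).
  case: s ssz sw sx sy {sD} => // m q [qsz] sw sx sy.
  apply: (le_trans (cell_diameter sw sx sy)).
  rewrite ler_pM2l ?(mesh_gt0 hw n)// lef_pV2 ?posrE ?ltr0n ?expn_gt0 ?(ltnW T_gt1)//.
  by rewrite ler_nat leq_exp2l// qsz.
have {bad} /choice[z zP] := bad.
pose x k := (z k).1; pose y k := (z k).2.
have [p [pD pcl]] : exists p, (Dset w n `&` cluster (x @ \oo)) p.
  apply: (@segment_compact R) => //.
  by exists 0%N => // k _; case: (zP k) => -[].
have frequently e k0 : 0 < e -> exists2 k, (k0 <= k)%N & `|p - x k| < e.
  move=> e0; have [||t [[k k0k <-] /= pt]] := pcl [set x k | k in [set k | (k0 <= k)%N]] (ball p e).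
  - by exists k0 => // k /= k0k; exists k.
  - exact: nbhsx_ballx.
  - by exists k.
have pK : Kset w La p.
  move=> k _; apply: Bset_closed => B /nbhs_ballP[e /= e0 eB].
  have [j kj pj] := frequently e k e0; exists (x j); split; last exact: eB.
  by apply: (Bset_decreasing kj); case: (zP j) => -[].
have Sp : 0 < Sf w n p by apply: Spos.
have /subspace_continuousP/(_ p pD)/cvgrPdist_lt := @Sf_continuous _ _ _ hw n.
have [eta [eta0 etaS etaa]] : exists eta : R,
    [/\ 0 < eta, eta < Sf w n p & Sf w n p + eta <= a * (Sf w n p - eta)].
  have a0 : 0 < a - 1 by rewrite subr_gt0.
  have a2 : 0 < a + 1 by rewrite (lt_trans _ (ltr_pwDr ltr01 (lexx a)))// (lt_trans ltr01).
  (* The solution of S_n(p) + eta = a (S_n(p) - eta). *)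
  exists (Sf w n p * ((a - 1) / (a + 1))); split.
  - by rewrite mulr_gt0// divr_gt0.
  - by rewrite gtr_pMr// ltr_pdivrMr// mul1r; lra.
  - by rewrite le_eqVlt; apply/orP; left; apply/eqP; field; rewrite gt_eqF.
move=> /(_ _ eta0); rewrite near_withinE => /nbhs_ballP[d /= d0 dS].
have Snear t : Dset w n t -> `|p - t| < d -> `|Sf w n p - Sf w n t| < eta.
  by move=> Dt pt; exact: dS.
have d20 : 0 < d / 2 by rewrite divr_gt0.
(* As T^k > k, any k >= k0 gives mesh / T^k < d / 2, which keeps y_k within d of p. *)
pose k0 := (Num.truncn (mesh w / (d / 2))).+1.
have [k k0k pxk] := frequently _ k0 d20.
have [[xD _] yD xy] := zP k; rewrite -/(x k) -/(y k) in xD yD xy *.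
have small : mesh w / (T ^ k)%:R < d / 2.
  rewrite ltr_pdivrMr ?ltr0n ?expn_gt0 ?(ltnW T_gt1)// mulrC -ltr_pdivrMr//.
  apply: (lt_le_trans (truncnS_gt _)); rewrite ler_nat (leq_trans k0k)//.
  by rewrite ltnW// ltn_expl.
have pyk : `|p - y k| < d.
  by rewrite (le_lt_trans (ler_distD (x k) _ _))// (splitr d) ltrD// (le_lt_trans xy).
have pxkd : `|p - x k| < d by lra.
have := Snear _ xD pxkd; rewrite ltr_distl => /andP[x1 x2].
have := Snear _ yD pyk; rewrite ltr_distl => /andP[y1 y2].
rewrite ltNge => /negP; apply.
rewrite !gtr0_norm; [|lra..].
apply: (@le_trans _ _ (a * (Sf w n p - eta))); first by lra.
by rewrite ler_pM2l; lra.
Qed.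

End Limit.

(** * From superharmonic functions to inequalities between radii *)

Lemma spectral_radius_le_of_superharmonic {R : realType} {N : nat} (w : rifs R N)
    (hw : rifs_axioms w) (La : {set 'I_N}) (T : nat) (T_gt0 : (0 < T)%N)
    (ratio : forall n, n \in La -> Dlen w n / Ilen w n = T%:R)
    (c c' : 'I_N -> set R -> R) (k k' : nat) (a : R) :
  (forall n E, 0 <= c n E) -> (forall n E, 0 <= c' n E) -> 0 < a ->
  (forall lam u, superharmonic w La c k lam u ->
     exists u', superharmonic w La c' k' (a * lam) u') ->
  spectral_radius (restrict_mx (kernel_mx w La T c' k'.+1) (@Theta R N w La T k'.+1))
  <= a * spectral_radius (restrict_mx (kernel_mx w La T c k.+1) (@Theta R N w La T k.+1)).
Proof.
move=> c0 c'0 a0 h; rewrite mulrC -ler_pdivrMr//; apply/ler_addgt0Pr => e e0.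
rewrite ler_pdivrMr// mulrC.
set sr := spectral_radius (restrict_mx (kernel_mx _ _ _ c _) _).
have sr0 : 0 <= sr.
  apply: spectral_radius_ge0 => i j.
  by rewrite /restrict_mx /kernel_mx !mxE; case: ifP.
have [|u /h[u' cu']] :=
  spectral_radius_lt_superharmonic hw T_gt0 ratio (k := k) (lam := sr + e) c0.
  by rewrite ltrDl.
apply: (spectral_radius_le_superharmonic hw T_gt0 ratio) cu' => //.
by rewrite mulr_ge0 ?addr_ge0// ltW.
Qed.

(** A path from n to itself has at least one edge; the first one supplies a letter that may precede
    n in a walk. *)
Lemma strongly_connected_pred {R : realType} {N : nat} (w : rifs R N) (V : {set 'I_N}) n :
  strongly_connected w V -> n \in V -> exists2 m, m \in V & edge w n m.
Proof.
move=> [_ sc] nV; have [p [p0 pn _ pV]] := sc _ _ nV nV.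
case: p p0 pn pV => // m p _ /= /andP[nm _] pV; exists m => //.
by apply: pV; rewrite !inE eqxx orbT.
Qed.

Lemma strongly_connected_succ {R : realType} {N : nat} (w : rifs R N) (V : {set 'I_N}) n :
  strongly_connected w V -> n \in V -> exists2 m, m \in V & edge w m n.
Proof.
move=> [_ sc] nV; have [p [p0 pn ln pV]] := sc _ _ nV nV.
case/lastP: p p0 pn ln pV => // p m _; rewrite rcons_path last_rcons => /andP[_ e] mn pV.
exists (last n p); last by rewrite -{2}mn.
by apply: pV; have := mem_last n p; rewrite !inE mem_rcons !inE; case/orP => ->; rewrite ?orbT.
Qed.

(** * Monotonicity, convergence and equality of the limits *)

Section Monotonicity.
Context {R : realType} {N : nat} (w : rifs R N) (hw : rifs_axioms w).
Context (La : {set 'I_N}) (T : nat) (T_gt1 : (1 < T)%N).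
Context (ratio : forall n, n \in La -> Dlen w n / Ilen w n = T%:R).
Context (sc : strongly_connected w La).

Let T_gt0 := ltnW T_gt1.
Let up k := rho_up w La T k.+1.
Let low k := rho_low w La T k.+1.

Lemma rho_up_step k : up k.+1 <= up k.
Proof.
rewrite -[leRHS]mul1r.
apply: (@spectral_radius_le_of_superharmonic _ _ w hw La T _ ratio
  (sup_kernel w) (sup_kernel w)) => //.
- by move=> n E; exact: sup_kernel_ge0.
- by move=> n E; exact: sup_kernel_ge0.
- move=> lam u uc; rewrite mul1r; eexists; exact: superharmonic_sup_refine uc.
Qed.

Lemma rho_low_step k : low k <= low k.+1.
Proof.
rewrite -[leRHS]mul1r.
apply: (@spectral_radius_le_of_superharmonic _ _ w hw La T _ ratio
  (inf_kernel w) (inf_kernel w)) => //.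
- by move=> n E; exact: inf_kernel_ge0.
- by move=> n E; exact: inf_kernel_ge0.
- move=> lam u uc; rewrite mul1r; apply: superharmonic_inf_coarsen uc => //.
  by move=> n; exact: strongly_connected_succ.
Qed.

Lemma rho_low_le_up k : low k <= up k.
Proof.
rewrite -[leRHS]mul1r.
apply: (@spectral_radius_le_of_superharmonic _ _ w hw La T _ ratio
  (sup_kernel w) (inf_kernel w)) => //.
- by move=> n E; exact: sup_kernel_ge0.
- by move=> n E; exact: inf_kernel_ge0.
- move=> lam u [u0 uc]; exists u; split => // s sw ssz; rewrite mul1r.
  apply: le_trans (uc _ sw ssz); apply: ler_sum => n nw.
  have [c0 cD] : cell w s !=set0 /\ cell w s `<=` Dset w n.
    by apply: walk_cell nw _ => //; rewrite -size_eq0 ssz.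
  rewrite ler_wpM2l ?inf_kernel_le_sup//.
  by apply/ltW/u0; [exact: walk_take|rewrite size_takel//= ssz].
Qed.

(** The same [u] serves both kernels: each weight grows at most by the factor [a]. *)
Lemma rho_up_le_low k a : 0 < a ->
  (forall n s x y, walk w La (n :: s) -> size s = k.+1 ->
    cell w s x -> cell w s y -> `|Sf w n x| <= a * `|Sf w n y|) ->
  up k <= a * low k.
Proof.
move=> a0 Sa.
apply: (@spectral_radius_le_of_superharmonic _ _ w hw La T _ ratio
  (inf_kernel w) (sup_kernel w)) => //.
- by move=> n E; exact: inf_kernel_ge0.
- by move=> n E; exact: sup_kernel_ge0.
- move=> lam u [u0 uc]; exists u; split => // s sw ssz.
  rewrite -mulrA; apply: le_trans (ler_wpM2l (ltW a0) (uc _ sw ssz)).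
  rewrite mulr_sumr; apply: ler_sum => n nw.
  have [c0 cD] : cell w s !=set0 /\ cell w s `<=` Dset w n.
    by apply: walk_cell nw _ => //; rewrite -size_eq0 ssz.
  rewrite mulrCA ler_wpM2l//.
    by apply/ltW/u0; [exact: walk_take|rewrite size_takel//= ssz].
  by apply: sup_kernel_le_inf => // x y; exact: Sa.
Qed.

Lemma rho_low_ge0 k : 0 <= low k.
Proof.
apply: spectral_radius_ge0 => i j; rewrite /restrict_mx /Mlow !mxE.
by case: ifP => // _; exact: inf_kernel_ge0.
Qed.

Lemma rho_up_nonincreasing : nonincreasing_seq up.
Proof. by apply/nonincreasing_seqP; exact: rho_up_step. Qed.

Lemma rho_low_nondecreasing : nondecreasing_seq low.
Proof. by apply/nondecreasing_seqP; exact: rho_low_step. Qed.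

Lemma rho_up_cvg : cvgn up.
Proof.
apply: nonincreasing_is_cvgn; first exact: rho_up_nonincreasing.
by exists 0 => _ [k _ <-]; exact: le_trans (rho_low_ge0 k) (rho_low_le_up k).
Qed.

Lemma rho_low_cvg : cvgn low.
Proof.
apply: nondecreasing_is_cvgn; first exact: rho_low_nondecreasing.
exists (up 0) => _ [k _ <-]; apply: le_trans (rho_low_le_up k) _.
exact: rho_up_nonincreasing.
Qed.

Lemma rho_lim_eq :
  (forall n, n \in La -> forall t, (Dset w n `&` Kset w La) t -> 0 < Sf w n t) ->
  limn low = limn up.
Proof.
move=> Spos; apply/le_anti/andP; split.
  by apply: ler_lim rho_low_cvg rho_up_cvg _; apply: nearW; exact: rho_low_le_up.
have L0 : 0 <= limn low.
  exact: le_trans (rho_low_ge0 0) (nondecreasing_cvgn_le rho_low_nondecreasing rho_low_cvg 0).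
have L1 : 0 < limn low + 1 by rewrite ltr_wpDl.
apply/ler_addgt0Pr => e e0.
(* Chosen so that a L <= L + e for the limit L of [low]; adding 1 to the denominator covers L =
   0. *)
pose a := 1 + e / (limn low + 1).
have a1 : 1 < a by rewrite ltrDl divr_gt0.
have : \forall k \near \oo, up k <= a * low k.
  have : \forall k \near \oo, forall n s x y, walk w La (n :: s) -> size s = k.+1 ->
      cell w s x -> cell w s y -> `|Sf w n x| <= a * `|Sf w n y|.
    apply: filter_forall => n; have [nLa|nLa] := boolP (n \in La).
      apply: (Sf_oscillation hw T_gt1 ratio _ nLa a1 (Spos n nLa)).
      by move=> m; exact: strongly_connected_pred.
    by apply: nearW => k s x y /walk_mem; rewrite (negPf nLa).
  by apply: filterS => k; apply: rho_up_le_low; exact: lt_trans a1.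
move=> [k _ /(_ k (leqnn k)) upk].
apply: le_trans (nonincreasing_cvgn_ge rho_up_nonincreasing rho_up_cvg k) _.
apply: (le_trans upk); apply: (@le_trans _ _ (a * limn low)).
  rewrite ler_pM2l ?(lt_trans _ a1)//.
  exact: nondecreasing_cvgn_le rho_low_nondecreasing rho_low_cvg k.
rewrite /a mulrDl mul1r lerD2l -mulrA ger_pMr// mulrC ler_pdivrMr// mul1r.
by rewrite lerDl.
Qed.

End Monotonicity.

Theorem theorem2p2 (R : realType) (N : nat) (hN : (2 <= N)%N) (w : rifs R N)
  (hw : rifs_axioms w)
  (m : nat) (La : 'I_m -> {set 'I_N}) (T : 'I_m -> nat)
  (La_inj : injective La)
  (La_comp : forall V : {set 'I_N},
     strong_component w V <-> exists r : 'I_m, La r = V)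
  (T_ge2 : forall r : 'I_m, (2 <= T r)%N)
  (T_ratio : forall (r : 'I_m) (n : 'I_N), n \in La r ->
     Dlen w n / Ilen w n = (T r)%:R)
  (r : 'I_m) :
  let up := fun k : nat => rho_up w (La r) (T r) k.+1 in
  let low := fun k : nat => rho_low w (La r) (T r) k.+1 in
  (nonincreasing_seq up /\ cvgn up) /\
  [/\ nondecreasing_seq low,
      cvgn low &
      (forall n : 'I_N, n \in La r ->
         forall t : R, (Dset w n `&` Kset w (La r)) t -> 0 < Sf w n t) ->
      limn low = limn up].
Proof.
have /La_comp[sc _] : exists r', La r' = La r by exists r.
have ratio := T_ratio r; have T1 := T_ge2 r.
split; first by split; [exact: rho_up_nonincreasing|exact: rho_up_cvg].
by split; [exact: rho_low_nondecreasing|exact: rho_low_cvg|exact: rho_lim_eq].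
Qed.
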